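(* Let $k$ be an algebraically closed field, $R=k[x,y]$, and let $S$ be any finite set of rank one valuations on $R$ that are trivial on $k^*$. Put $R_S=\bigcap_{v\in S}\{P\in R : v(P)\ge 0\}$ and let $\delta(S)\in\{0,1,2\}$ be the transcendence degree over $k$ of the fraction field of $R_S$. Then $\delta(S)=2$ if and only if there exists a nonzero polynomial $P\in R$ satisfying $v(P)>0$ for all $v\in S$.
   Context: A rank one valuation on $R=k[x,y]$ is a nontrivial real-valued valuation of the field $k(x,y)$, regarded as a function on $R$ (with $v(0)=+\infty$). $R_S$ is a $k$-subalgebra of $R$. *)

(* Defs.v *)
From mathcomp Require Import all_boot all_order all_algebra.
From mathcomp Require Import boolp classical_sets cardinality reals.
From mathcomp Require Import constructive_ereal ereal.
(* The notations of mpoly clash with those of constructive_ereal. *)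
From mathcomp Require Import -(notations) mpoly.

Set Implicit Arguments.
Unset Strict Implicit.
Unset Printing Implicit Defensive.

Import Order.TTheory GRing.Theory Num.Theory.

Local Open Scope classical_set_scope.
Local Open Scope ring_scope.

Notation "{ 'mpoly' k [ n ] }" := (mpoly n k) : type_scope.

Definition ratfun (k : fieldType) : fieldType := {fraction {mpoly k[2]}}.

Definition embP (k : fieldType) (P : {mpoly k[2]}) : ratfun k := tofrac P.

Definition embC (k : fieldType) : {rmorphism k -> ratfun k} :=
  @tofrac {mpoly k[2]} \o @mpolyC 2 k.

Record rank_one_valuation (R : realType) (K : fieldType) (v : K -> \bar R) :
    Prop := RankOneValuation {
  val_zero : v 0 = +oo%E;
  val_fin : forall a : K, a != 0 -> v a \is a fin_num;
  val_mul : forall a b : K, v (a * b) = (v a + v b)%E;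
  val_add : forall a b : K, (Order.min (v a) (v b) <= v (a + b)%R)%E;
  val_nontrivial : exists2 a : K, a != 0 & v a != 0%E
}.

Definition trivial_on_constants (R : realType) (k : fieldType)
    (v : ratfun k -> \bar R) : Prop :=
  forall c : k, c != 0 -> v (embC k c) = 0%E.

Definition nonneg_subalgebra (R : realType) (k : fieldType)
    (S : set (ratfun k -> \bar R)) : set {mpoly k[2]} :=
  \bigcap_(v in S) [set P | (0 <= v (embP P))%E].

Definition fraction_field (k : fieldType) (A : set {mpoly k[2]}) :
    set (ratfun k) :=
  [set embP P / embP Q | P in A & Q in A `\ 0].

Definition alg_independent (k K : fieldType) (iota : {rmorphism k -> K})
    (n : nat) (t : n.-tuple K) : Prop :=
  forall p : {mpoly k[n]}, mmap iota (tnth t) p = 0 -> p = 0.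

(* A transcendence basis is a maximal algebraically independent family. *)
Definition transcendence_basis (k K : fieldType) (iota : {rmorphism k -> K})
    (L : set K) (n : nat) (t : n.-tuple K) : Prop :=
  [/\ forall i, L (tnth t i), alg_independent iota t
    & forall z, L z -> ~ alg_independent iota [tuple of z :: t]].

(* The default value 0 of get is only met when L has no finite transcendence
   basis, which does not happen inside ratfun k. *)
Definition trdeg (k K : fieldType) (iota : {rmorphism k -> K}) (L : set K) :
    nat :=
  get [set d : nat | exists t : d.-tuple K, transcendence_basis iota L t].

Definition delta (R : realType) (k : fieldType)
    (S : set (ratfun k -> \bar R)) : nat :=
  trdeg (embC k) (fraction_field (nonneg_subalgebra S)).

(* Main.v *)
Require Import Defs.
From HB Require Import structures.
From mathcomp Require Import all_boot all_order all_algebra.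
From mathcomp Require Import boolp classical_sets cardinality reals.
From mathcomp Require Import constructive_ereal ereal.
From mathcomp Require Import zify.
From mathcomp Require Import -(notations) mpoly.
Set Implicit Arguments.
Unset Strict Implicit.
Unset Printing Implicit Defensive.

Import Order.TTheory GRing.Theory Num.Theory.

Local Open Scope classical_set_scope.
Local Open Scope ring_scope.

(** The two implications rest on the fact that k(x,y) has transcendence degree 2
over k.

Suppose that delta S = 2, and fix v in S.  If v vanished on all nonzero elements
of the algebra R_S, it would vanish on its fraction field L, and then on
everything algebraic over L ([val_root_eq0]): in a polynomial relation with
coefficients of value 0, the terms have values proportional to their exponents,
so that exactly one of them is the smallest.  But L contains two algebraically
independent elements, so k(x,y) is algebraic over L ([ratfun_dependent]) and v
would be trivial.  Hence some nonzero P_v in R_S has v(P_v) > 0, and every other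
valuation of S is nonnegative at P_v.  The product of the P_v over v in S is
positive at every valuation of S ([exists_common_pos]).

Conversely, let P be positive on S.  For each polynomial A, the value
n v(P) + v(A) of P^n A is nonnegative for all v in the finite set S once n is
large, so P^n A lies in R_S.  Every fraction A / B equals P^n A / P^n B, so the
fraction field of R_S is k(x,y) ([delta_of_common_pos]).

As the transcendence degree is the size of some transcendence basis, all bases
of k(x,y) must be shown to have size 2 ([trdeg_ratfun]).  More than two
elements are dependent because the number of monomials of bounded exponents in
them outgrows the dimension of the space of polynomials of the corresponding
degree in x and y.  A single element t is never a basis: leading monomials show
that t cannot be algebraic both over k(x) and over k(y)
([singleton_not_maximal]). *)

(** * Valuations and algebraic elements *)

Section Valuation.
Variables (R : realType) (K : fieldType) (v : K -> \bar R).
Hypothesis rv : rank_one_valuation v.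

Let w (a : K) : R := fine (v a).

Let vE a : a != 0 -> v a = (w a)%:E.
Proof. by move=> a0; rewrite fineK // (val_fin rv). Qed.

Let wM a b : a != 0 -> b != 0 -> w (a * b) = w a + w b.
Proof.
move=> a0 b0; apply: EFin_inj.
by rewrite EFinD -!vE ?mulf_neq0 // (val_mul rv).
Qed.

Lemma val_one : v 1 = 0%E.
Proof.
rewrite vE ?oner_neq0 //; congr EFin; have := wM (oner_neq0 K) (oner_neq0 K).
by rewrite mulr1 -{1}[w 1]addr0 => /addrI.
Qed.

Lemma val_opp a : v (- a) = v a.
Proof.
have [->|a0] := eqVneq a 0; first by rewrite oppr0.
have N0 : (- 1 : K) != 0 by rewrite oppr_eq0 oner_neq0.
have wN : w (-1) = 0.
  have := wM N0 N0; rewrite mulrNN mulr1 {1}/w val_one /= => /esym/eqP.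
  by rewrite -mulr2n mulrn_eq0 /= => /eqP.
by rewrite -mulN1r !vE ?mulf_neq0 // wM // wN add0r.
Qed.

Lemma fine_val_exp a n : a != 0 -> fine (v (a ^+ n)) = fine (v a) *+ n.
Proof.
move=> a0; elim: n => [|n IHn]; first by rewrite expr0 val_one.
by rewrite exprS [LHS]wM ?expf_neq0 // /w IHn mulrS.
Qed.

Lemma val_sum_gt (I : Type) (r : seq I) (P : pred I) (F : I -> K) (g : \bar R) :
  (g < +oo)%E -> (forall i, P i -> (g < v (F i))%E) ->
  (g < v (\sum_(i <- r | P i) F i))%E.
Proof.
move=> g_fin gF; elim/big_ind: _ => //; first by rewrite (val_zero rv).
move=> a b ga gb; apply: lt_le_trans (val_add rv a b).
by rewrite lt_min ga gb.
Qed.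

Lemma sum_neq0_of_unique_min (I : finType) (F : I -> K) i0 :
  F i0 != 0 -> (forall i, i != i0 -> (v (F i0) < v (F i))%E) ->
  \sum_i F i != 0.
Proof.
move=> F0 Fmin; apply/eqP; rewrite (bigD1 i0) //= => /eqP.
rewrite addr_eq0 => /eqP eqF.
have gfin : (v (F i0) < +oo)%E by rewrite vE // ltry.
by have := val_sum_gt (index_enum I) gfin Fmin; rewrite {1}eqF val_opp ltxx.
Qed.

(** A valuation that is trivial on the coefficients of a polynomial is trivial on
its nonzero roots: if v f were positive (negative), the nonzero term of lowest
(highest) exponent would be the only one of minimal value, and the sum of the
terms could not vanish. *)
Lemma val_root_eq0 (q : {poly K}) f :
  q != 0 -> (forall i, q`_i != 0 -> v q`_i = 0%E) -> root q f -> f != 0 ->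
  v f = 0%E.
Proof.
move=> q0 vq /rootP qf0 f0; rewrite vE //; congr EFin; apply/eqP.
apply/negP => /negP wf0; move/eqP: qf0; apply/negP.
have termE i : q`_i != 0 -> v (q`_i * f ^+ i) = (w f *+ i)%:E.
  move=> qi; have fi : f ^+ i != 0 by rewrite expf_neq0.
  by rewrite (val_mul rv) vq // add0e vE // /w fine_val_exp.
have [n qn nmin] : exists2 n, q`_n != 0 &
    forall i, q`_i != 0 -> i != n -> w f *+ n < w f *+ i.
  have [wf|wf|/esym/eqP] := ltgtP 0 (w f); last by rewrite (negPf wf0).
    have ex : exists n, q`_n != 0.
      by exists (size q).-1; rewrite -lead_coefE lead_coef_eq0.
    exists (ex_minn ex); case: ex_minnP => // n qn nmin i qi ni.
    by rewrite ltr_pMn2l // ltn_neqAle eq_sym ni nmin.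
  exists (size q).-1 => [|i qi ni]; first by rewrite -lead_coefE lead_coef_eq0.
  rewrite ltr_nMn2l // ltn_neqAle ni -ltnS prednK ?size_poly_gt0 //.
  by rewrite ltnNge; apply: contraNN qi => /(nth_default 0) ->.
have nlt : (n < size q)%N.
  by rewrite ltnNge; apply: contraNN qn => /(nth_default 0) ->.
rewrite horner_coef.
apply: (@sum_neq0_of_unique_min _ _ (Ordinal nlt)) => [|i ni] /=.
  by rewrite mulf_neq0 // expf_neq0.
rewrite termE //; have [->|qi] := eqVneq q`_i 0.
  by rewrite mul0r (val_zero rv) ltry.
by rewrite termE // lte_fin nmin.
Qed.

End Valuation.

(** * Algebraic dependence and univariate polynomials *)

Lemma mmap_rcons (k K : fieldType) (iota : {rmorphism k -> K}) n
    (t : n.-tuple K) f (p : {mpoly k[n.+1]}) :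
  mmap iota (tnth (rcons_tuple t f)) p =
  (map_poly (mmap iota (tnth t)) (muni p)).[f].
Proof.
rewrite muniE rmorph_sum /= horner_sum; apply: eq_bigr => m _.
rewrite map_polyZ map_polyXn /= hornerZ hornerXn mmapZ mmapX -mulrA.
congr (_ * _); rewrite /mmap1 big_ord_recr /=; congr (_ * _ ^+ _).
  apply: eq_bigr => i _; rewrite mnmE; congr (_ ^+ _).
  rewrite !(tnth_nth 0) /= nth_rcons size_tuple ltn_ord //.
by rewrite (tnth_nth 0) /= nth_rcons size_tuple ltnn eqxx.
Qed.

(** The coefficient of [p] at [m] is found in [muni p] by splitting the last
exponent of [m] from the others, so no coefficient is lost. *)
Lemma muni_neq0 (k : fieldType) n (p : {mpoly k[n.+1]}) : p != 0 -> muni p != 0.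
Proof.
move=> p0; have mp := mlead_supp p0; set m := mlead p in mp.
pose res (m : multinom n.+1) := Multinom [tuple m (widen_ord (leqnSn n) i) | i < n].
suff E : mcoeff (res m) (muni p)`_(m ord_max) = mcoeff m p.
  apply/eqP => m0; move: mp; rewrite mcoeff_msupp -E m0 coef0 mcoeff0 eqxx //.
rewrite muniE coef_sum raddf_sum /= (bigD1_seq m) //= coefZ coefXn eqxx mulr1.
rewrite mcoeffZ mcoeffX eqxx mulr1 big1 ?addr0 // => m' m'm.
rewrite coefZ coefXn; have [mm|_] := eqVneq (m ord_max) (m' ord_max); last first.
  by rewrite mulr0 mcoeff0.
rewrite mulr1 mcoeffZ mcoeffX; case: eqVneq => [rm|_]; last by rewrite mulr0.
case/eqP: m'm; apply/mnmP => i.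
case: (unliftP ord_max i) => [j ->|-> //].
have -> : lift ord_max j = widen_ord (leqnSn n) j.
  by apply: val_inj; rewrite /= /bump leqNgt ltn_ord.
by have /mnmP/(_ j) := rm; rewrite !mnmE.
Qed.

(** The coefficients of the equation of [f] are kept as polynomials in [t] that
are not yet evaluated; when [t] is independent, evaluation keeps the equation
nonzero. *)
Lemma root_of_dependent (k K : fieldType) (iota : {rmorphism k -> K}) n
    (t : n.-tuple K) f : ~ alg_independent iota (rcons_tuple t f) ->
  exists2 q : {poly {mpoly k[n]}}, q != 0 &
    root (map_poly (mmap iota (tnth t)) q) f.
Proof.
move=> /existsNP[p /not_implyP[pf /eqP p0]]; exists (muni p).
  exact: muni_neq0.
by rewrite /root -mmap_rcons pf.
Qed.

(** * Three rational functions in two variables are dependent *)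

Lemma exists_linear_relation (k : fieldType) (I J : finType) (F : I -> J -> k) :
  (#|J| < #|I|)%N ->
  exists2 u : I -> k, exists i, u i != 0 &
    forall j, \sum_i u i * F i j = 0.
Proof.
move=> JI.
pose M : 'M[k]_(#|I|, #|J|) := \matrix_(i, j) F (enum_val i) (enum_val j).
have : kermx M != 0.
  rewrite -mxrank_eq0 mxrank_ker -lt0n subn_gt0.
  exact: leq_ltn_trans (rank_leq_col M) JI.
case/rowV0Pn => u /sub_kermxP uM /rV0Pn[i0 ui0].
exists (fun i => u 0 (enum_rank i)) => [|j].
  by exists (enum_val i0); rewrite enum_valK.
have /matrixP/(_ 0 (enum_rank j)) := uM; rewrite !mxE => uM0; rewrite -[RHS]uM0.
rewrite [RHS](reindex (@enum_rank I)); last exact/onW_bij/enum_rank_bij.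
by apply: eq_bigr => i _; rewrite !mxE !enum_rankK.
Qed.

(** Being a morphism into [ratfun k] itself, [embP] can be computed with without
unfolding to the fraction field that [ratfun k] stands for. *)
HB.instance Definition _ (k : fieldType) :=
  GRing.isZmodMorphism.Build {mpoly k[2]} (ratfun k) (@embP k)
    (@tofrac_is_zmod_morphism {mpoly k[2]}).

HB.instance Definition _ (k : fieldType) :=
  GRing.isMonoidMorphism.Build {mpoly k[2]} (ratfun k) (@embP k)
    (@tofrac_is_monoid_morphism {mpoly k[2]}).

Lemma embP_eq0 (k : fieldType) (P : {mpoly k[2]}) : (embP P == 0) = (P == 0).
Proof. exact: tofrac_eq0. Qed.

Lemma embCE (k : fieldType) (c : k) : embC k c = embP (mpolyC 2 c).
Proof. by []. Qed.

Lemma ratfun_frac (k : fieldType) (f : ratfun k) :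
  exists P Q : {mpoly k[2]}, Q != 0 /\ f = embP P / embP Q.
Proof.
elim/quotW: f => x; exists (\n_x), (\d_x); split; first exact: denom_ratioP.
have d0 : embP \d_x != 0 by rewrite tofrac_eq0 denom_ratioP.
apply: (mulIf d0); rewrite mulfVK // /embP; unlock FracField.tofrac.
rewrite -[LHS]FracField.pi_mul; apply/eqmodP; rewrite /= FracField.equivfE.
rewrite /FracField.mulf !numden_Ratio ?mulf_neq0 ?oner_neq0 ?denom_ratioP //.
by rewrite !mulr1 mulrC.
Qed.

Lemma msizeM_bound (k : fieldType) n (P Q : {mpoly k[n]}) d e :
  (msize P <= d.+1)%N -> (msize Q <= e.+1)%N -> (msize (P * Q) <= (d + e).+1)%N.
Proof.
move=> Pd Qe; have [->|P0] := eqVneq P 0; first by rewrite mul0r mmeasure0.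
have [->|Q0] := eqVneq Q 0; first by rewrite mulr0 mmeasure0.
rewrite msizeM // -ltnS prednK; last by rewrite addn_gt0 lt0n msize_poly_eq0 P0.
by rewrite (leq_trans (leq_add Pd Qe)) // addSn addnS.
Qed.

Lemma msizeX_bound (k : fieldType) n (P : {mpoly k[n]}) d e :
  (msize P <= d.+1)%N -> (msize (P ^+ e) <= (d * e).+1)%N.
Proof.
move=> Pd; elim: e => [|e IHe]; first by rewrite expr0 msize1.
by rewrite exprS mulnS msizeM_bound.
Qed.

Lemma msize_prod_bound (k : fieldType) n (I : finType) (F : I -> {mpoly k[n]}) d :
  (forall i, msize (F i) <= d.+1)%N ->
  (msize (\prod_i F i) <= (#|I| * d).+1)%N.
Proof.
move=> Fd; rewrite -sum_nat_const.
elim/big_rec2: _ => [|i s P _ Ps]; first by rewrite msize1.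
exact: msizeM_bound.
Qed.

Lemma mpoly2_eq0 (k : fieldType) (P : {mpoly k[2]}) (M : nat) :
  (msize P <= M)%N ->
  (forall a : 'I_2 -> 'I_M, mcoeff (Multinom [tuple (a i : nat) | i < 2]) P = 0) ->
  P = 0.
Proof.
move=> PM P0; apply/mpolyP => m; rewrite mcoeff0; apply/eqP/negPn/negP => mP.
have mM i : (m i < M)%N.
  apply: leq_trans PM; rewrite -mcoeff_msupp in mP.
  apply: leq_ltn_trans (msize_mdeg_lt mP); rewrite mdegE (bigD1 i) //=.
  exact: leq_addr.
case/negP: mP; rewrite -(P0 (fun i => Ordinal (mM i))).
by apply/eqP; congr mcoeff; apply/mnmP => i; rewrite mnmE.
Qed.

Lemma expr_div_clear (K : fieldType) (a b : K) e N : b != 0 -> (e <= N)%N ->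
  (a / b) ^+ e * b ^+ N = a ^+ e * b ^+ (N - e).
Proof.
move=> b0 eN; rewrite expr_div_n -{1}(subnKC eN) exprD mulrA mulfVK //.
by rewrite expf_neq0.
Qed.

(** A box of n > 2 exponents up to N has (N+1)^n elements, while polynomials in
two variables with exponents at most nDN have (nDN+1)^2 coefficients, which is
only quadratic in N. *)
Lemma exists_box_size n D : (2 < n)%N ->
  exists N, ((n * (D * N)).+1 ^ 2 < N.+1 ^ n)%N.
Proof.
(* With N = (nD+1)^2, already (N+1)^3 > N (N+1)^2 = ((nD+1)(N+1))^2. *)
move=> n2; pose N := ((n * D).+1 ^ 2)%N; exists N.
apply: (@leq_trans (N.+1 ^ 3)%N); last exact: leq_pexp2l.
apply: (@leq_trans (N.+1 * N.+1 ^ 2)%N); last by rewrite -expnS.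
rewrite mulSn -[X in (X < _)%N]add0n -addSn leq_add ?expn_gt0 //.
by rewrite -expnMn leq_exp2r // mulnA mulSn mulnS addSn ltnS addnA leq_addl.
Qed.

(** Write the elements as fractions A i / B i.  After multiplication by the
product of the B i ^+ N, all monomials in them with exponents at most N become
polynomials of degree at most nDN.  There are more of these monomials than
coefficients in such polynomials, whence a linear relation. *)
Lemma ratfun_dependent (k : fieldType) n (t : n.-tuple (ratfun k)) :
  (2 < n)%N -> ~ alg_independent (embC k) t.
Proof.
move=> n2 indep.
have /choice[AB tE] (i : 'I_n) : exists AB : {mpoly k[2]} * {mpoly k[2]},
    AB.2 != 0 /\ tnth t i = embP AB.1 / embP AB.2.
  by have [P [Q PQ]] := ratfun_frac (tnth t i); exists (P, Q).
pose A i := (AB i).1; pose B i := (AB i).2.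
pose D := (\max_i maxn (msize (A i)) (msize (B i)))%N.
have AD i : (msize (A i) <= D.+1)%N.
  by apply: leqW; rewrite /D (bigD1 i) //= !leq_max leqnn.
have BD i : (msize (B i) <= D.+1)%N.
  by apply: leqW; rewrite /D (bigD1 i) //= !leq_max leqnn orbT.
have [N boxN] := exists_box_size D n2; pose M := (n * (D * N)).+1.
pose I := {ffun 'I_n -> 'I_N.+1}; pose J := {ffun 'I_2 -> 'I_M}.
have JI : (#|J| < #|I|)%N.
  by rewrite !card_ffun !card_ord.
pose G (e : I) := \prod_i (A i ^+ e i * B i ^+ (N - e i)).
have GM e : (msize (G e) <= M)%N.
  rewrite /M -[n in (n * _)%N]card_ord; apply: msize_prod_bound => i.
  have eN : (e i <= N)%N by rewrite -ltnS.
  rewrite -[X in (D * X)%N](subnKC eN) mulnDr.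
  by rewrite msizeM_bound // msizeX_bound.
pose mon (a : J) := Multinom [tuple (a i : nat) | i < 2].
have [u [e0 ue0] uG] := exists_linear_relation (fun e a => mcoeff (mon a) (G e)) JI.
have {}uG : \sum_e u e *: G e = 0.
  apply: (@mpoly2_eq0 _ _ M) => [|a].
    apply: leq_trans (mmeasure_sum _ _ _ _) _.
    by apply/bigmax_leqP => e _; apply: leq_trans (mmeasureZ_le _ _ _) (GM e).
  rewrite raddf_sum /= -[RHS](uG [ffun i => a i]); apply: eq_bigr => e _.
  rewrite mcoeffZ; congr (_ * mcoeff _ _).
  by apply/mnmP => i; rewrite !mnmE ffunE.
pose expo (e : I) := Multinom [tuple (e i : nat) | i < n].
have expo_inj : injective expo.
  move=> e e' /mnmP ee; apply/ffunP => i; apply: val_inj.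
  by have := ee i; rewrite !mnmE.
pose p := \sum_e u e *: mpolyX k (expo e).
suff p0 : p = 0.
  case/eqP: ue0; have := congr1 (mcoeff (expo e0)) p0.
  rewrite mcoeff0 raddf_sum /= (bigD1 e0) //= big1 => [|e ee].
    by rewrite mcoeffZ mcoeffX eqxx mulr1 addr0.
  by rewrite mcoeffZ mcoeffX (inj_eq expo_inj) (negPf ee) mulr0.
apply: indep; pose C := \prod_i B i ^+ N.
have C0 : embP C != 0.
  by rewrite embP_eq0; apply/prodf_neq0 => i _; rewrite expf_neq0 ?(tE i).1.
apply: (mulIf C0); rewrite mul0r /p raddf_sum mulr_suml.
rewrite -[RHS](rmorph0 (@embP k)) -uG rmorph_sum; apply: eq_bigr => e _ /=.
rewrite mmapZ mmapX -mulrA -mul_mpolyC rmorphM embCE; congr (_ * _).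
rewrite /mmap1 /C /G !rmorph_prod -big_split; apply: eq_bigr => i _ /=.
have [Bi tEi] := tE i.
have Bi0 : embP (B i) != 0 by rewrite embP_eq0.
have eN : (e i <= N)%N by rewrite -ltnS.
rewrite rmorphM !rmorphXn /= -(expr_div_clear _ Bi0 eN).
by rewrite tEi mnmE.
Qed.

(** * Variables are independent *)

(** The variables of [{mpoly k[n]}] are sent to distinct variables among x and y
by [h]: the identity gives both variables, a constant [h] on ['I_1] gives one. *)
Section Renaming.
Variables (k : fieldType) (n : nat) (h : 'I_n -> 'I_2).
Hypothesis h_inj : injective h.

Let push (m : multinom n) : multinom 2 :=
  Multinom [tuple (\sum_(i | h i == j) m i)%N | j < 2].

Let pushE m i : push m (h i) = m i.
Proof.
rewrite mnmE (bigD1 i) //= big1 ?addn0 // => i' /andP[/eqP/h_inj -> ].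
by rewrite eqxx.
Qed.

Definition rename_vars (p : {mpoly k[n]}) : {mpoly k[2]} :=
  mmap (@mpolyC 2 k) (fun i => mpolyX k (mnm1 (h i))) p.

Let renameE p : rename_vars p = \sum_(m <- msupp p) mcoeff m p *: mpolyX k (push m).
Proof.
apply: eq_bigr => m _; rewrite -mul_mpolyC; congr (_ * _).
rewrite mpolyXE_id /mmap1 (partition_big h predT) //=.
apply: eq_bigr => j _; rewrite mnmE expr_sum.
by apply: eq_bigr => i /eqP ->.
Qed.

Lemma embP_rename_vars p :
  mmap (embC k) (fun i => embP (mpolyX k (mnm1 (h i)))) p = embP (rename_vars p).
Proof.
rewrite rmorph_sum; apply: eq_bigr => m _; rewrite rmorphM; congr (_ * _).
by rewrite rmorph_prod; apply: eq_bigr => i _; rewrite rmorphXn.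
Qed.

Lemma rename_vars_eq0 p : (rename_vars p == 0) = (p == 0).
Proof.
apply/eqP/eqP => [p0|->]; last by rewrite /rename_vars mmap0.
apply/mpolyP => m; rewrite mcoeff0.
have := congr1 (mcoeff (push m)) p0; rewrite mcoeff0 renameE raddf_sum /= => <-.
rewrite [LHS](_ : _ = \sum_(m' <- msupp p) mcoeff m' p * (m' == m)%:R).
  apply: eq_bigr => m' _; rewrite mcoeffZ mcoeffX; congr (_ * _%:R).
  suff -> : (push m' == push m) = (m' == m) by [].
  apply/eqP/eqP => [mm|-> //]; apply/mnmP => i.
  by rewrite -!pushE mm.
rewrite [p in LHS]mpolyE raddf_sum /=; apply: eq_bigr => m' _.
by rewrite mcoeffZ mcoeffX.
Qed.

Lemma mlead_rename_vars p j : j \notin codom h -> mlead (rename_vars p) j = 0%N.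
Proof.
move=> jh; have [->|r0] := eqVneq (rename_vars p) 0.
  by rewrite mlead0 mnm0E.
have := mlead_supp r0; rewrite mcoeff_msupp; set l := mlead _ => /eqP r1.
apply/eqP; apply: contra_notT r1 => /negP j0.
rewrite renameE raddf_sum big1 //= => m _; rewrite mcoeffZ mcoeffX.
case: eqP => [mm|]; last by rewrite mulr0.
case: j0; rewrite -mm mnmE big1 // => i /eqP hi.
by rewrite -hi codom_f in jh.
Qed.

Lemma variables_independent (t : n.-tuple (ratfun k)) :
  (forall i, tnth t i = embP (mpolyX k (mnm1 (h i)))) ->
  alg_independent (embC k) t.
Proof.
move=> tE p; have -> : tnth t = fun i => embP (mpolyX k (mnm1 (h i))).
  exact/funext.
by rewrite embP_rename_vars => /eqP; rewrite embP_eq0 rename_vars_eq0 => /eqP.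
Qed.

End Renaming.

(** * A single rational function is not a transcendence basis *)

Lemma sum_neq0_of_distinct_mlead (k : fieldType) n (I : finType)
    (F : I -> {mpoly k[n]}) i0 : F i0 != 0 ->
  (forall i j, F i != 0 -> F j != 0 -> mlead (F i) = mlead (F j) -> i = j) ->
  \sum_i F i != 0.
Proof.
move=> Fi0 inj.
have [i Fi imax] := @Order.TotalTheory.arg_maxP _ _ _ i0 (fun i => F i != 0)
  (fun i => mlead (F i)) Fi0.
suff : mcoeff (mlead (F i)) (\sum_i F i) != 0.
  by apply: contraNneq => ->; rewrite mcoeff0.
rewrite raddf_sum (bigD1 i) //= big1 ?addr0 ?mleadc_eq0 // => j ji.
have [->|Fj] := eqVneq (F j) 0; first by rewrite mcoeff0.
apply: mcoeff_gt_mlead; rewrite lt_neqAle; apply/andP; split; last exact: imax.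
by apply: contraNneq ji => /(inj _ _ Fj Fi) ->.
Qed.

(** Subtracting a constant from the fraction A / B makes its numerator and its
denominator differ in leading monomial: if the leading monomials agree, the
quotient of the leading coefficients is the right constant. *)
Lemma exists_shift_mlead_neq (k : fieldType) n (A B : {mpoly k[n]}) : B != 0 ->
  exists c : k, A - c *: B != 0 -> mlead (A - c *: B) != mlead B.
Proof.
move=> B0; have [AB|AB] := eqVneq (mlead A) (mlead B); last first.
  by exists 0 => _; rewrite scale0r subr0.
exists (mleadc A / mleadc B); apply: contraNneq => CB.
by rewrite -mleadc_eq0 CB mcoeffB mcoeffZ AB divfK ?subrr ?mleadc_eq0.
Qed.

(** If A / B is algebraic over k(X_i), with an equation of degree less than s, clearing
denominators gives a vanishing sum of the g_e A^e B^(s-e) with g_e in k[X_i].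
With a and b the exponents of X_j in the leading monomials of A and B, the
exponent of X_j in the leading monomial of such a term is a e + b (s - e).  If
a and b differed, these would be distinct, and the sum could not vanish. *)
Lemma dependent_mlead_eq (k : fieldType) (A B : {mpoly k[2]}) (i j : 'I_2) :
  A != 0 -> B != 0 -> i != j ->
  (exists2 q : {poly {mpoly k[1]}}, q != 0 &
    root (map_poly (mmap (embC k) (fun=> embP (mpolyX k (mnm1 i)))) q)
      (embP A / embP B)) ->
  mlead A j = mlead B j.
Proof.
move=> A0 B0 ij [q q0 /rootP]; pose h := fun _ : 'I_1 => i.
have h_inj : injective h by move=> x y _; rewrite !ord1.
have jh : j \notin codom h.
  by apply/codomP => -[x /eqP]; rewrite eq_sym (negPf ij).
apply: contra_eq => AB; rewrite horner_poly.
pose s := size q.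
pose F (e : 'I_s) := rename_vars h q`_e * A ^+ e * B ^+ (s - e).
have F0 e : (F e != 0) = (q`_e != 0).
  rewrite /F !mulf_eq0 !negb_or !expf_neq0 // !andbT.
  by rewrite rename_vars_eq0.
have mF e : F e != 0 -> mlead (F e) j = (mlead A j * e + mlead B j * (s - e))%N.
  move=> Fe; rewrite /F !mleadM ?mleadX ?expf_neq0 //.
  - by rewrite !mnmDE !mulmnE mlead_rename_vars.
  - by move: Fe; rewrite F0 rename_vars_eq0.
  - by rewrite mulf_neq0 ?expf_neq0 //; move: Fe; rewrite F0 rename_vars_eq0.
have sum0 : \sum_e F e != 0.
  have sq : (s.-1 < s)%N by rewrite prednK // size_poly_gt0.
  apply: (@sum_neq0_of_distinct_mlead _ _ _ _ (Ordinal sq)).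
    by rewrite F0 -lead_coefE lead_coef_eq0.
  move=> e e' Fe Fe' /(congr1 (fun m : multinom 2 => m j)); rewrite !mF // => E.
  apply: val_inj; have := ltn_ord e; have := ltn_ord e'.
  move: E AB; set a := mlead A j; set b := mlead B j; move=> /= E /eqP AB l l'.
  nia.
move: sum0; rewrite -(@embP_eq0 k) rmorph_sum /=.
apply: contraNneq => S0; apply/eqP.
rewrite -[RHS](mul0r (embP B ^+ s)) -[in RHS]S0 mulr_suml.
apply: eq_bigr => e _; rewrite (embP_rename_vars h).
rewrite /F !rmorphM !rmorphXn -!mulrA; congr (_ * _).
by rewrite expr_div_clear ?embP_eq0 // ltnW.
Qed.

(** If each of x and y depended on [a], then so it would with a - c = C / B for
any constant c.  Both exponents of the leading monomials of C and B would
agree by [dependent_mlead_eq], but c can be chosen so that they do not. *)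
Lemma singleton_not_maximal (k : fieldType) (t : 1.-tuple (ratfun k)) :
  alg_independent (embC k) t ->
  exists z, alg_independent (embC k) [tuple of z :: t].
Proof.
case/tupleP: t => a t; rewrite [t]tuple0 => indep.
apply: contrapT => /forallNP dep.
have [A [B [B0 tE]]] := ratfun_frac a.
have [c AB] := exists_shift_mlead_neq A B0; set C := A - c *: B in AB.
have tC : a - embC k c = embP C / embP B.
  have B0' : embP B != 0 by rewrite embP_eq0.
  by rewrite /C -mul_mpolyC rmorphB rmorphM mulrBl mulfK ?B0' ?tE ?embCE.
have [C0|C0] := eqVneq C 0.
  (* Then a is the constant c, hence not transcendental. *)
  have /mpolyP/(_ (mnm1 ord0)) : mpolyX k (mnm1 (@ord0 0)) - mpolyC 1 c = 0.
    apply: indep; rewrite rmorphB /= mmapX mmapC mmap1U; apply/eqP.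
    by move: tC; rewrite C0 rmorph0 mul0r => /eqP.
  rewrite mcoeff0 mcoeffB mcoeffX mcoeffC eqxx mnm1_eq0 mulr0 subr0.
  by move/eqP; rewrite oner_eq0.
case/eqP: (AB C0); apply/mnmP => j; pose i := rev_ord j.
have ij : i != j by rewrite -val_eqE /=; case: j {i} => [[|[]]].
apply: (dependent_mlead_eq C0 B0 ij).
have /root_of_dependent[q q0 qt] :
    ~ alg_independent (embC k) (rcons_tuple [tuple embP (mpolyX k (mnm1 i))] a).
  move=> ind; apply: (dep (embP (mpolyX k (mnm1 i)))).
  rewrite (_ : [tuple of _ :: _] = rcons_tuple [tuple embP (mpolyX k (mnm1 i))] a) //.
  exact: val_inj.
(* Translating the equation of a by c gives one for a - c. *)
exists (q \Po ('X + (mpolyC 1 c)%:P)).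
  by rewrite -size_poly_eq0 size_comp_poly2 ?size_XaddC // size_poly_eq0.
rewrite -tC /root -(_ : mmap (embC k) (tnth [tuple embP (mpolyX k (mnm1 i))]) =
    mmap (embC k) (fun=> embP (mpolyX k (mnm1 i)))).
  rewrite map_comp_poly horner_comp rmorphD /= map_polyX map_polyC /= mmapC.
  by rewrite hornerD hornerX hornerC subrK.
by congr mmap; apply/funext => x; rewrite ord1.
Qed.

(** * The theorem *)

(** All transcendence bases have to be considered, since [trdeg] is the size of an
unspecified one. *)
Lemma trdeg_ratfun (k : fieldType) : trdeg (embC k) [set: ratfun k] = 2%N.
Proof.
apply: get_unique => [|d [t [_ indep tmax]]].
  exists [tuple embP (mpolyX k (mnm1 i)) | i < 2]; split => // [|z _].
    by apply: (variables_independent (h := id)) => // i; rewrite tnth_mktuple.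
  exact: ratfun_dependent.
case: d => [|[|[|d]]] in t indep tmax *; first 1 last.
- by have [z /(tmax z I)] := singleton_not_maximal indep.
- by [].
- by case: (ratfun_dependent (t := t)).
case: (tmax (embP (mpolyX k (mnm1 ord0))) I).
apply: (variables_independent (h := fun=> ord0)) => i.
  by move=> j _; rewrite !ord1.
by rewrite ord1.
Qed.

Lemma fraction_field_mmap (k : fieldType) (A : set {mpoly k[2]}) n
    (t : n.-tuple (ratfun k)) p :
  (forall c, A (mpolyC 2 c)) ->
  (forall P Q, A P -> A Q -> A (P + Q)) -> (forall P Q, A P -> A Q -> A (P * Q)) ->
  (forall i, fraction_field A (tnth t i)) ->
  fraction_field A (mmap (embC k) (tnth t) p).
Proof.
move=> AC AD AM tA.
have emb0 (Q : {mpoly k[2]}) : Q != 0 -> embP Q != 0 by rewrite embP_eq0.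
have LC c : fraction_field A (embC k c).
  exists (mpolyC 2 c); first exact: AC.
  exists 1; first by split; [exact: AC|apply/eqP; rewrite oner_neq0].
  by rewrite rmorph1 divr1.
have LM f g : fraction_field A f -> fraction_field A g -> fraction_field A (f * g).
  move=> [P AP [Q [AQ /eqP Q0] <-]] [P' AP' [Q' [AQ' /eqP Q0'] <-]].
  exists (P * P'); first exact: AM.
  exists (Q * Q'); first by split; [exact: AM|apply/eqP; rewrite mulf_neq0].
  by rewrite !rmorphM mulf_div.
have LD f g : fraction_field A f -> fraction_field A g -> fraction_field A (f + g).
  move=> [P AP [Q [AQ /eqP Q0] <-]] [P' AP' [Q' [AQ' /eqP Q0'] <-]].
  exists (P * Q' + P' * Q); first by apply: AD; exact: AM.
  exists (Q * Q'); first by split; [exact: AM|apply/eqP; rewrite mulf_neq0].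
  by rewrite addf_div ?emb0 // rmorphD !rmorphM.
rewrite /mmap; elim/big_ind: _ => [|f g|m _].
- by rewrite -(rmorph0 (embC k)); exact: LC.
- exact: LD.
apply: (LM); first exact: LC.
rewrite /mmap1; elim/big_ind: _ => [|f g|i _].
- by rewrite -(rmorph1 (embC k)); exact: LC.
- exact: LM.
elim: (m i) => [|e IHe].
  by rewrite expr0 -(rmorph1 (embC k)); exact: LC.
by rewrite exprS; apply: LM.
Qed.

Section Intersection.
Variables (R : realType) (k : fieldType) (S : set (ratfun k -> \bar R)).
Hypothesis valS : forall v, S v -> rank_one_valuation v /\ trivial_on_constants v.

Lemma nonneg_const c : nonneg_subalgebra S (mpolyC 2 c).
Proof.
move=> v /valS[rv tv] /=; have [->|c0] := eqVneq c 0.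
  by rewrite /embP mpolyC0 rmorph0 (val_zero rv) leey.
by rewrite -embCE tv.
Qed.

Lemma nonneg_add P Q : nonneg_subalgebra S P -> nonneg_subalgebra S Q ->
  nonneg_subalgebra S (P + Q).
Proof.
move=> SP SQ v Sv /=; have [rv _] := valS Sv; rewrite rmorphD.
apply: le_trans (val_add rv _ _); rewrite le_min.
by have := SP v Sv; have := SQ v Sv => /= -> ->.
Qed.

Lemma nonneg_mul P Q : nonneg_subalgebra S P -> nonneg_subalgebra S Q ->
  nonneg_subalgebra S (P * Q).
Proof.
move=> SP SQ v Sv /=; have [rv _] := valS Sv; rewrite rmorphM (val_mul rv).
by apply: adde_ge0; [exact: SP|exact: SQ].
Qed.

(** Otherwise v is trivial on R_S, hence on its fraction field, hence on all of
k(x,y), which is algebraic over that field. *)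
Lemma exists_pos_of_delta2 v : delta S = 2%N -> S v ->
  exists P, [/\ P != 0, nonneg_subalgebra S P & (0 < v (embP P))%E].
Proof.
move=> d2 Sv; have [rv tv] := valS Sv; apply: contrapT => /forallNP nP.
have v0 P : nonneg_subalgebra S P -> P != 0 -> v (embP P) = 0%E.
  move=> SP P0; have := SP v Sv; rewrite /= le_eqVlt => /orP[/eqP <- //|vP].
  by case: (nP P).
pose L := fraction_field (nonneg_subalgebra S).
have vL f : L f -> f != 0 -> v f = 0%E.
  move=> [P SP [Q [SQ /eqP Q0] fE]] f0.
  have Q0' : embP Q != 0 by rewrite embP_eq0.
  have PE : f * embP Q = embP P by rewrite -fE divfK.
  have := val_mul rv f (embP Q); rewrite PE !v0 ?adde0 //.
  by apply: contraNneq f0 => P0; rewrite -fE P0 rmorph0 mul0r.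
have [t [tL indep _]] : exists t : 2.-tuple _, transcendence_basis (embC k) L t.
  suff : [set d | exists t : d.-tuple _, transcendence_basis (embC k) L t] 2%N by [].
  rewrite -d2; apply: getPex; apply: contrapT => /forallNP nb.
  by move: d2; rewrite /delta /trdeg getPN.
have [a a0 /eqP[]] := val_nontrivial rv.
have /root_of_dependent[q q0 qa] :
    ~ alg_independent (embC k) (rcons_tuple t a) by exact: ratfun_dependent.
apply: (val_root_eq0 rv _ _ qa a0) => [|i].
  apply: contraNneq q0 => mq; rewrite -lead_coef_eq0 lead_coefE.
  apply/eqP/indep; have := congr1 (fun r : {poly _} => r`_(size q).-1) mq.
  by rewrite coef_map coef0.
rewrite coef_map /=; apply: vL; apply: fraction_field_mmap tL.
- exact: nonneg_const.
- exact: nonneg_add.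
- exact: nonneg_mul.
Qed.

(** The product of the polynomials given by [exists_pos_of_delta2] for the
various v: at each valuation of S one factor is positive and the others are
nonnegative. *)
Lemma exists_common_pos : finite_set S -> delta S = 2%N ->
  exists2 P : {mpoly k[2]}, P != 0 & forall v, S v -> (0 < v (embP P))%E.
Proof.
move=> /finite_seqP[s sE] d2.
have [P [P0 SP Ps]] : exists P, [/\ P != 0, nonneg_subalgebra S P &
    forall v, v \in s -> (0 < v (embP P))%E].
  have : {subset s <= [pred v | `[< S v >]]}.
    by move=> v vs; apply/asboolP; rewrite sE.
  elim: s {sE} => [|v s IHs] sS.
    exists 1; split => //; first exact: oner_neq0.
    by rewrite -mpolyC1; exact: nonneg_const.
  have [u us|P [P0 SP Ps]] := IHs; first by apply: sS; rewrite inE us orbT.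
  have Sv : S v by apply/asboolP/sS; rewrite inE eqxx.
  have [Q [Q0 SQ Qv]] := exists_pos_of_delta2 d2 Sv.
  exists (P * Q); split; [by rewrite mulf_neq0|exact: nonneg_mul|].
  move=> u; rewrite inE => us.
  have Su : S u by apply/asboolP/sS.
  have [ru _] := valS Su; rewrite rmorphM (val_mul ru).
  case/predU1P: us => [->|us].
    by apply: lte_paddl => //; exact: SP.
  by apply: lte_paddr; [exact: SQ|exact: Ps].
by exists P => // v; rewrite sE /=; exact: Ps.
Qed.

(** High powers of P make any polynomial nonnegative on S, by finiteness of S and
because the values are real numbers. *)
Lemma delta_of_common_pos P : finite_set S -> P != 0 ->
  (forall v, S v -> (0 < v (embP P))%E) -> delta S = 2%N.
Proof.
move=> /finite_seqP[s sE] P0 vP.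
have emb0 (Q : {mpoly k[2]}) : Q != 0 -> embP Q != 0 by rewrite embP_eq0.
have pow A : exists N, forall n, (N <= n)%N -> nonneg_subalgebra S (P ^+ n * A).
  have [->|A0] := eqVneq A 0.
    by exists 0%N => n _; rewrite mulr0 -mpolyC0; exact: nonneg_const.
  suff [N Ns] : exists N, forall n, (N <= n)%N ->
      forall v, v \in s -> S v -> (0 <= v (embP (P ^+ n * A)%R))%E.
    by exists N => n Nn v Sv; apply: Ns => //; move: Sv; rewrite sE.
  elim: s {sE} => [|v s [N Ns]]; first by exists 0%N.
  have [Sv|nSv] := pselect (S v); last first.
    exists N => n Nn u; rewrite inE => /predU1P[-> //|]; exact: Ns.
  have [rv _] := valS Sv.
  have vPf := val_fin rv (emb0 _ P0); have vAf := val_fin rv (emb0 _ A0).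
  have wP : 0 < fine (v (embP P)) by rewrite -lte_fin fineK // vP.
  pose M := Num.bound `|(fine (v (embP P)))^-1 * - fine (v (embP A))|.
  exists (maxn N M) => n; rewrite geq_max => /andP[Nn Mn] u.
  rewrite inE => /predU1P[-> _|]; last exact: Ns.
  rewrite rmorphM rmorphXn (val_mul rv).
  rewrite -[v (_ ^+ n)]fineK ?(val_fin rv) ?expf_neq0 ?emb0 //.
  rewrite (fine_val_exp rv) ?emb0 // -[v (embP A)]fineK ?vAf //.
  rewrite -EFinD lee_fin -mulr_natr -lerBlDr sub0r -ler_pdivrMl //.
  apply: le_trans (ler_norm _) (le_trans (ltW (archi_boundP (normr_ge0 _))) _).
  by rewrite ler_nat.
suff L : fraction_field (nonneg_subalgebra S) = setT.
  by rewrite /delta L trdeg_ratfun.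
apply/seteqP; split => // f _; have [A [B [B0 ->]]] := ratfun_frac f.
have [[a Aa] [b Bb]] := (pow A, pow B).
exists (P ^+ maxn a b * A); first by apply: Aa; exact: leq_maxl.
exists (P ^+ maxn a b * B); first split.
- by apply: Bb; exact: leq_maxr.
- by apply/eqP; rewrite mulf_neq0 ?expf_neq0.
by rewrite !rmorphM -mulf_div divff ?mul1r // emb0 // expf_neq0.
Qed.

End Intersection.

Theorem theorem1p1 (R : realType) (k : closedFieldType)
    (S : set (ratfun k -> \bar R))
    (finS : finite_set S)
    (valS : forall v, S v -> rank_one_valuation v /\ trivial_on_constants v) :
  delta S = 2%N <->
  exists2 P : {mpoly k[2]}, P != 0 & forall v, S v -> (0 < v (embP P))%E.
Proof.
split; first exact: exists_common_pos.
by case=> P; exact: delta_of_common_pos.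
Qed.
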